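(* Let $A$ be a unital $\ast$-algebra and let $M\cong\rho(A^d)=A^d\cdot\rho_\beta$ and $N\cong\varsigma(A^s)=A^s\cdot\varsigma_\alpha$ be two finitely generated projective left $A$-modules, where $\rho\in\mathrm{End}(A^d)$ and $\varsigma\in\mathrm{End}(A^s)$ are idempotents with $\rho_\beta^\dagger=\rho_\beta$ and $\varsigma_\alpha^\dagger=\varsigma_\alpha$, and where $M$ also carries a compatible right $A$-module structure, so that the left $A$-module $M\otimes_A N$ is defined. Assume that $M\otimes_A N$ is a finitely generated projective left $A$-module too, by embedding it in $A^d\otimes_A A^s\cong A^{ds}$ as the image of an idempotent left $A$-module endomorphism of $A^{ds}$, and that the matrix in $M_{ds}(A)$ of this idempotent is self-adjoint with respect to $\dagger$. Then every left $A$-module morphism $C:M\otimes_A N\to M\otimes_A N$ is $A$-adjointable with respect to the Hermitian structure induced on $M\otimes_A N$ by $(-,-)^\otimes_{\mathrm{L}}$.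
   Context: $\ast$-algebras are complex, associative and unital, with antilinear, antimultiplicative involution $\ast$. The canonical Hermitian structure on the free left $A$-module $A^d$ is $(\overline{x},\overline{y})^d_{\mathrm{L}}=\sum_{i=1}^d x_i\,y_i^\ast$. $\mathrm{End}(A^d)$ is the set of left $A$-module endomorphisms of $A^d$; each $C\in\mathrm{End}(A^d)$ has a matrix $C_\beta\in M_d(A)$ with respect to the canonical basis $\beta$, determined by $C(\overline{x})=\overline{x}\cdot C_\beta$ (row vector times matrix). For a matrix $X$ over $A$, $X^\dagger$ is the conjugate transpose, $(X^\dagger)_{ij}=(X_{ji})^\ast$. The free left $A$-module $A^d\otimes_A A^s$ (with the usual bimodule structure on $A^d$) is identified with $A^{ds}$ by $\overline{\beta}_i\otimes_A\overline{\alpha}_j\leftrightarrow\overline{e}_{(i-1)s+j}$, where $\{\overline{\beta}_i\}$, $\{\overline{\alpha}_j\}$, $\{\overline{e}_k\}$ are the canonical bases of $A^d$, $A^s$, $A^{ds}$. Under this identification the canonical Hermitian structure of $A^{ds}$ becomes $$(\overline{x}\otimes_A\overline{y},\overline{u}\otimes_A\overline{v})^\otimes_{\mathrm{L}}=(\overline{x}\,(\overline{y},\overline{v})^s_{\mathrm{L}},\overline{u})^d_{\mathrm{L}}\in A.$$ The induced structure on $M\otimes_A N$ is its restriction along the given embedding. A left $A$-module endomorphism $C$ of a left $A$-module $E$ with Hermitian structure $(-,-):E\times E\to A$ is $A$-adjointable if there is a left $A$-module endomorphism $C^\star$ of $E$ with $(C(x),y)=(x,C^\star(y))$ for all $x,y\in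 E$. *)

(* Defs.v *)
From HB Require Import structures.
From mathcomp Require Import all_boot all_order all_algebra.
From mathcomp Require Import generic_quotient ring_quotient complex freeg.
From mathcomp Require Import boolp classical_sets reals.

Set Implicit Arguments.
Unset Strict Implicit.
Unset Printing Implicit Defensive.

Import GRing.Theory Num.Theory.
Local Open Scope ring_scope.

(* The complex numbers are R[i] with R : realType. The algebra axioms are     *)
(* spelled out over pzRingType because algType R[i] requires 1 != 0 and would *)
(* exclude the zero algebra; see Algebra_isStarAlgebra for the link.          *)
HB.mixin Record PzRing_isStarAlgebra (R : realType) A of GRing.PzRing A := {
  cscale : R[i] -> A -> A;
  cscaleA : forall k l a, cscale k (cscale l a) = cscale (k * l) a;
  cscale1 : forall a, cscale 1 a = a;
  cscaleDr : forall k a b, cscale k (a + b) = cscale k a + cscale k b;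
  cscaleDl : forall k l a, cscale (k + l) a = cscale k a + cscale l a;
  cscaleAl : forall k a b, cscale k (a * b) = cscale k a * b;
  cscaleAr : forall k a b, cscale k (a * b) = a * cscale k b;
  star : A -> A;
  starD : forall a b, star (a + b) = star a + star b;
  starZ : forall (k : R[i]) a, star (cscale k a) = cscale k^* (star a);
  starM : forall a b, star (a * b) = star b * star a;
  starK : involutive star
}.
#[short(type="starAlgType")]
HB.structure Definition StarAlgebra (R : realType) :=
  {A of GRing.PzRing A & PzRing_isStarAlgebra R A}.

HB.factory Record Algebra_isStarAlgebra (R : realType) A
    of GRing.Algebra R[i] A := {
  star : A -> A;
  starD : forall a b, star (a + b) = star a + star b;
  starZ : forall (k : R[i]) a, star (k *: a) = k^* *: star a;
  starM : forall a b, star (a * b) = star b * star a;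
  starK : involutive star
}.
HB.builders Context R A of Algebra_isStarAlgebra R A.
HB.instance Definition _ := PzRing_isStarAlgebra.Build R A
  (@scalerA _ A) (@scale1r _ A) (@scalerDr _ A)
  (fun k l a => scalerDl a k l) (@scalerAl _ A) (@scalerAr _ A)
  starD starZ starM starK.
HB.end.

HB.mixin Record Lmodule_isBimodule (A : pzRingType) M of GRing.Lmodule A M := {
  ract : M -> A -> M;
  ractDl : forall (x y : M) a, ract (x + y) a = ract x a + ract y a;
  ractDr : forall (x : M) a b, ract x (a + b) = ract x a + ract x b;
  ractA : forall (x : M) a b, ract x (a * b) = ract (ract x a) b;
  ract1 : forall x : M, ract x 1 = x;
  scaler_ract : forall a (x : M) b, ract (a *: x) b = a *: ract x b
}.
#[short(type="bimodType")]
HB.structure Definition Bimodule (A : pzRingType) :=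
  {M of GRing.Lmodule A M & Lmodule_isBimodule A M}.

Section MatrixBimodule.
Variables (A : pzRingType) (m n : nat).
Implicit Types (x y : 'M[A]_(m, n)) (a b : A).

Definition mx_ract x a : 'M[A]_(m, n) := map_mx (fun c => c * a) x.

Fact mx_ractDl x y a : mx_ract (x + y) a = mx_ract x a + mx_ract y a.
Proof. by apply/matrixP=> i j; rewrite !mxE mulrDl. Qed.
Fact mx_ractDr x a b : mx_ract x (a + b) = mx_ract x a + mx_ract x b.
Proof. by apply/matrixP=> i j; rewrite !mxE mulrDr. Qed.
Fact mx_ractA x a b : mx_ract x (a * b) = mx_ract (mx_ract x a) b.
Proof. by apply/matrixP=> i j; rewrite !mxE mulrA. Qed.
Fact mx_ract1 x : mx_ract x 1 = x.
Proof. by apply/matrixP=> i j; rewrite !mxE mulr1. Qed.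
Fact mx_scaler_ract a x b : mx_ract (a *: x) b = a *: mx_ract x b.
Proof. by apply/matrixP=> i j; rewrite !mxE mulrA. Qed.

HB.instance Definition _ := Lmodule_isBimodule.Build A 'M[A]_(m, n)
  mx_ractDl mx_ractDr mx_ractA mx_ract1 mx_scaler_ract.
End MatrixBimodule.

HB.instance Definition _ (R : nzRingType) (K : choiceType) (V : lmodType R)
    (f : K -> V) :=
  GRing.isZmodMorphism.Build {freeg K / R} V (fglift f) (lift_is_additive f).

(* M ⊗_A N: the quotient of the free abelian group on M * N by the subgroup   *)
(* generated by the biadditivity and balancing relations.                     *)
Section Tensor.
Variables (A : pzRingType) (M : bimodType A) (N : lmodType A).

Inductive tensor_rel : {freeg (M * N)%type} -> Prop :=
| TensorRel0 : tensor_rel 0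
| TensorRelB u v : tensor_rel u -> tensor_rel v -> tensor_rel (u - v)
| TensorRelDl x x' y :
    tensor_rel (<< (x + x', y) >> - (<< (x, y) >> + << (x', y) >>))
| TensorRelDr x y y' :
    tensor_rel (<< (x, y + y') >> - (<< (x, y) >> + << (x, y') >>))
| TensorRelA x a y : tensor_rel (<< (ract x a, y) >> - << (x, a *: y) >>).

Definition tensor_relb : pred {freeg (M * N)%type} :=
  fun u => `[< tensor_rel u >].

Fact tensor_relb_closed : zmod_closed tensor_relb.
Proof.
split=> [|u v /asboolP ru /asboolP rv]; apply/asboolP.
  exact: TensorRel0.
exact: TensorRelB.
Qed.
HB.instance Definition _ :=
  GRing.isZmodClosed.Build _ tensor_relb tensor_relb_closed.

Definition tensor_relZ : zmodClosed {freeg (M * N)%type} :=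
  GRing.ZmodClosed.clone _ tensor_relb _.
Definition tensor : Type := Quotient.quot tensor_relZ.
HB.instance Definition _ := GRing.Zmodule.on tensor.

Definition tens (x : M) (y : N) : tensor :=
  \pi_(Quotient.quot tensor_relZ)%qT << (x, y) >>.

Lemma tensDl x x' y : tens (x + x') y = tens x y + tens x' y.
Proof.
rewrite /tens -[RHS]raddfD; apply/eqP.
by rewrite -Quotient.idealrBE; apply/asboolP/TensorRelDl.
Qed.

Lemma tensDr x y y' : tens x (y + y') = tens x y + tens x y'.
Proof.
rewrite /tens -[RHS]raddfD; apply/eqP.
by rewrite -Quotient.idealrBE; apply/asboolP/TensorRelDr.
Qed.

Lemma tens_ract x a y : tens (ract x a) y = tens x (a *: y).
Proof.
rewrite /tens; apply/eqP.
by rewrite -Quotient.idealrBE; apply/asboolP/TensorRelA.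
Qed.

Lemma tensor_ind (P : tensor -> Prop) :
    P 0 -> (forall t u, P t -> P u -> P (t + u)) -> (forall t, P t -> P (- t)) ->
  (forall x y, P (tens x y)) -> forall t, P t.
Proof.
move=> P0 PD PN Pt t; rewrite -[t]reprK -[repr t]freeg_sumE.
elim/big_ind: _ => [|u v Pu Pv|[x y] _]; first by rewrite raddf0.
  by rewrite raddfD; apply: PD.
have ->: << coeff (x, y) (repr t) *g (x, y) >>
       = << (x, y) >> *~ coeff (x, y) (repr t) :> {freeg (M * N)%type}.
  by rewrite freegU_mulz intz.
have Pn n : P (tens x y *+ n) by elim: n => // n IHn; rewrite mulrS; apply: PD.
rewrite raddfMz; case: (coeff _ _) => n; first exact: Pn.
by rewrite NegzE mulrNz; apply/PN/Pn.
Qed.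

Definition balanced (G : zmodType) (f : M -> N -> G) : Prop :=
  [/\ forall x x' y, f (x + x') y = f x y + f x' y,
      forall x y y', f x (y + y') = f x y + f x y'
    & forall x a y, f (ract x a) y = f x (a *: y)].

Definition tensor_lift (G : zmodType) (f : M -> N -> G) (t : tensor) : G :=
  fglift (fun xy => f xy.1 xy.2 : zmodule G) (repr t).

Lemma tensor_lift_pi (G : zmodType) (f : M -> N -> G) u : balanced f ->
  tensor_lift f (\pi_(Quotient.quot tensor_relZ)%qT u)
    = fglift (fun xy => f xy.1 xy.2 : zmodule G) u.
Proof.
move=> [fDl fDr fA]; set F := fglift _.
have FB : {morph F : v w / v - w} by apply: lift_is_additive.
have FD : {morph F : v w / v + w} by move=> v w; rewrite /F raddfD.
have FU x y : F << (x, y) >> = f x y by rewrite /F liftU scale1r.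
have F0 v : tensor_rel v -> F v = 0.
  elim=> [|v1 v2 _ F1 _ F2|x x' y|x y y'|x a y].
  - by rewrite /F raddf0.
  - by rewrite FB F1 F2 subrr.
  - by rewrite FB FD !FU fDl subrr.
  - by rewrite FB FD !FU fDr subrr.
  - by rewrite FB !FU fA subrr.
rewrite /tensor_lift -/F; apply/eqP; rewrite -subr_eq0 -FB; apply/eqP/F0.
apply/asboolP; have := Quotient.idealrBE tensor_relZ (repr (\pi_(Quotient.quot tensor_relZ)%qT u)) u.
by rewrite reprK eqxx.
Qed.

Lemma tensor_lift_tens (G : zmodType) (f : M -> N -> G) x y : balanced f ->
  tensor_lift f (tens x y) = f x y.
Proof. by move=> f_bal; rewrite tensor_lift_pi // liftU scale1r. Qed.

Lemma tensor_liftB (G : zmodType) (f : M -> N -> G) : balanced f ->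
  zmod_morphism (tensor_lift f).
Proof.
move=> f_bal t u; rewrite -[t]reprK -[u]reprK -raddfB !tensor_lift_pi //.
exact: (lift_is_additive (fun xy => f xy.1 xy.2 : zmodule G)).
Qed.

Lemma tensor_liftD (G : zmodType) (f : M -> N -> G) t u : balanced f ->
  tensor_lift f (t + u) = tensor_lift f t + tensor_lift f u.
Proof.
move=> f_bal; rewrite -[t]reprK -[u]reprK -raddfD !tensor_lift_pi //.
exact: (raddfD (fglift (fun xy => f xy.1 xy.2 : zmodule G))).
Qed.

Definition tensor_scale (a : A) : tensor -> tensor :=
  tensor_lift (fun x y => tens (a *: x) y).

Fact tensor_scale_bal a : balanced (fun x y => tens (a *: x) y).
Proof.
split=> [x x' y|x y y'|x b y]; first by rewrite scalerDr tensDl.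
  exact: tensDr.
by rewrite -scaler_ract tens_ract.
Qed.

Fact tensor_scale_tens a x y : tensor_scale a (tens x y) = tens (a *: x) y.
Proof. exact: tensor_lift_tens (tensor_scale_bal a). Qed.

Fact tensor_scaleDr a t u :
  tensor_scale a (t + u) = tensor_scale a t + tensor_scale a u.
Proof. exact: tensor_liftD (tensor_scale_bal a). Qed.

Fact tensor_scale0 a : tensor_scale a 0 = 0.
Proof. by apply: (addIr (tensor_scale a 0)); rewrite -tensor_scaleDr !add0r. Qed.

Fact tensor_scaleN a t : tensor_scale a (- t) = - tensor_scale a t.
Proof. by apply/eqP; rewrite -addr_eq0 -tensor_scaleDr addNr tensor_scale0. Qed.

Fact tensor_scaleA a b t :
  tensor_scale a (tensor_scale b t) = tensor_scale (a * b) t.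
Proof.
elim/tensor_ind: t => [|t u IHt IHu|t IHt|x y]; first by rewrite !tensor_scale0.
- by rewrite !tensor_scaleDr IHt IHu.
- by rewrite !tensor_scaleN IHt.
by rewrite !tensor_scale_tens scalerA.
Qed.

Fact tensor_scale1 : left_id 1 tensor_scale.
Proof.
elim/tensor_ind=> [|t u IHt IHu|t IHt|x y]; first by rewrite !tensor_scale0.
- by rewrite !tensor_scaleDr IHt IHu.
- by rewrite !tensor_scaleN IHt.
by rewrite !tensor_scale_tens scale1r.
Qed.

Fact tensor_scaleDl t a b :
  tensor_scale (a + b) t = tensor_scale a t + tensor_scale b t.
Proof.
elim/tensor_ind: t => [|t u IHt IHu|t IHt|x y].
- by rewrite !tensor_scale0 addr0.
- by rewrite !tensor_scaleDr IHt IHu addrACA.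
- by rewrite !tensor_scaleN IHt opprD.
by rewrite !tensor_scale_tens scalerDl tensDl.
Qed.

HB.instance Definition _ := GRing.Zmodule_isLmodule.Build A tensor
  tensor_scaleA tensor_scale1 tensor_scaleDr
  (fun t a b => tensor_scaleDl t a b).

Lemma tensZ a x y : a *: tens x y = tens (a *: x) y.
Proof. exact: tensor_scale_tens. Qed.

Lemma tensor_liftZ (V : lmodType A) (f : M -> N -> V) : balanced f ->
  (forall a x y, f (a *: x) y = a *: f x y) -> scalable (tensor_lift f).
Proof.
move=> f_bal fZ a; have fD t u := tensor_liftD t u f_bal.
have f0 : tensor_lift f 0 = 0.
  by apply: (addIr (tensor_lift f 0)); rewrite -fD !add0r.
have fN t : tensor_lift f (- t) = - tensor_lift f t.
  by apply/eqP; rewrite -addr_eq0 -fD addNr f0.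
elim/tensor_ind=> [|t u IHt IHu|t IHt|x y].
- by rewrite f0 !scaler0.
- by rewrite scalerDr !fD IHt IHu scalerDr.
- by rewrite scalerN !fN IHt scalerN.
by rewrite tensZ !tensor_lift_tens.
Qed.

End Tensor.

(* The identification of A^d ⊗_A A^s with A^(ds): mxvec is row-major, so the  *)
(* entry of index i * s + j of the image of x ⊗ y is x_i * y_j.               *)
Section TensorRow.
Variables (A : pzRingType) (d s : nat).
Local Notation Ad := 'rV[A]_d.
Local Notation As := 'rV[A]_s.

Definition tensor_rV : tensor Ad As -> 'rV[A]_(d * s) :=
  tensor_lift (fun (x : Ad) (y : As) => mxvec (x^T *m y)).

Fact tensor_rV_bal : balanced (fun (x : Ad) (y : As) => mxvec (x^T *m y)).
Proof.
split=> [x x' y|x y y'|x a y].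
- by rewrite linearD mulmxDl linearD.
- by rewrite mulmxDr linearD.
congr mxvec; apply/matrixP=> i j; rewrite !mxE; apply: eq_bigr => k _.
by rewrite !mxE mulrA.
Qed.

Lemma tensor_rVE x y : tensor_rV (tens x y) = mxvec (x^T *m y).
Proof. exact: tensor_lift_tens tensor_rV_bal. Qed.

Fact tensor_rV_zmod_morphism : zmod_morphism tensor_rV.
Proof. exact: tensor_liftB tensor_rV_bal. Qed.
HB.instance Definition _ :=
  GRing.isZmodMorphism.Build _ _ tensor_rV tensor_rV_zmod_morphism.

Fact tensor_rV_scalable : scalable tensor_rV.
Proof.
apply: tensor_liftZ tensor_rV_bal _ => a x y.
apply/rowP; case/mxvec_indexP=> i j; rewrite !(mxvecE, mxE) mulr_sumr.
by apply: eq_bigr => k _; rewrite !mxE mulrA.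
Qed.
HB.instance Definition _ :=
  GRing.isScalable.Build A _ _ _ tensor_rV tensor_rV_scalable.

Lemma tensor_rV_basis (i : 'I_d) (j : 'I_s) :
  tensor_rV (tens (delta_mx 0 i) (delta_mx 0 j)) = delta_mx 0 (mxvec_index i j).
Proof. by rewrite tensor_rVE trmx_delta mul_delta_mx mxvec_delta. Qed.

Lemma tensor_rV_bij : bijective tensor_rV.
Proof.
pose g (v : 'rV[A]_(d * s)) : tensor Ad As :=
  \sum_i tens (delta_mx 0 i) (row i (vec_mx v)).
have gD : {morph g : u v / u + v}.
  move=> u v; rewrite /g -big_split; apply: eq_bigr => i _ /=.
  by rewrite -tensDr !linearD.
have g0 : g 0 = 0 by apply: (addIr (g 0)); rewrite -gD !add0r.
have gN v : g (- v) = - g v by apply/eqP; rewrite -addr_eq0 -gD addNr g0.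
exists g => [t|v].
  elim/tensor_ind: t => [|t u IHt IHu|t IHt|x y].
  - by rewrite raddf0.
  - by rewrite raddfD gD IHt IHu.
  - by rewrite raddfN gN IHt.
  rewrite tensor_rVE /g mxvecK.
  have tens0 : tens (0 : Ad) y = 0.
    by apply: (addIr (tens (0 : Ad) y)); rewrite -tensDl !add0r.
  have tens_sum (F : 'I_d -> Ad) : tens (\sum_i F i) y = \sum_i tens (F i) y.
    by elim/big_rec2: _ => // i t z _ <-; rewrite tensDl.
  have xE: x = \sum_i ract (delta_mx 0 i : Ad) (x 0 i).
    apply/rowP=> k; rewrite summxE (bigD1 k) //= big1 => [|i i_k].
      by rewrite !mxE !eqxx mul1r addr0.
    by rewrite !mxE eq_sym (negPf i_k) andbF mul0r.
  rewrite [in RHS]xE tens_sum; apply: eq_bigr => i _; rewrite tens_ract.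
  by congr tens; apply/rowP=> k; rewrite !mxE big_ord1 !mxE.
rewrite /g raddf_sum /=; apply: (can_inj vec_mxK); apply/row_matrixP=> i.
rewrite linear_sum linear_sum (bigD1 i) //= tensor_rVE mxvecK trmx_delta.
rewrite big1 ?addr0 => [|j j_i].
  by rewrite row_mul rowE mul_delta_mx -rowE; apply/rowP=> k; rewrite !mxE.
by rewrite tensor_rVE mxvecK trmx_delta row_mul rowE mul_delta_mx_0 ?mul0mx // eq_sym.
Qed.
End TensorRow.

Lemma index_allpairs (S T : eqType) (s : seq S) (t : seq T) x y :
    x \in s -> y \in t ->
  index (x, y) [seq (x, y) | x <- s, y <- t] = (index x s * size t + index y t)%N.
Proof.
move=> + t_y; elim: s => //= z s IHs.
rewrite inE index_cat size_map eq_sym.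
have [<- _|z_x /= s_x] := eqVneq z x.
  by rewrite map_f // index_map // => u v [].
rewrite ifN; last by apply/mapP => -[u _ [x_z _]]; rewrite x_z eqxx in z_x.
by rewrite IHs // mulSn addnA.
Qed.

Lemma mxvec_index_val d s (i : 'I_d) (j : 'I_s) :
  mxvec_index i j = (i * s + j)%N :> nat.
Proof.
have rankE (T : finType) (x : T) : enum_rank x = index x (enum T) :> nat.
  by rewrite /enum_rank enum_rank_in.unlock insubdK // -topredE /= cardE index_mem mem_enum.
rewrite /= rankE enumT unlock index_allpairs ?mem_enum //.
by rewrite size_enum_ord !index_enum_ord.
Qed.

Section Hermitian.
Variables (R : realType) (A : starAlgType R).

Definition dagger m n (X : 'M[A]_(m, n)) : 'M[A]_(n, m) := map_mx star X^T.

Definition herm n (x y : 'rV[A]_n) : A := \sum_i x 0 i * star (y 0 i).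

(* The Hermitian structure of A^(ds) read on A^d ⊗_A A^s; herm_tensorE gives *)
(* its value (x (y, v), u) on simple tensors.                                *)
Definition herm_tensor d s (t u : tensor 'rV[A]_d 'rV[A]_s) : A :=
  herm (tensor_rV t) (tensor_rV u).

Lemma herm_tensorE d s (x u : 'rV[A]_d) (y v : 'rV[A]_s) :
  herm_tensor (tens x y) (tens u v) = herm (ract x (herm y v)) u.
Proof.
rewrite /herm_tensor !tensor_rVE /herm.
under [RHS]eq_bigr do rewrite mxE mulr_sumr mulr_suml.
rewrite pair_bigA (reindex _ (curry_mxvec_bij _ _)) /=.
apply: eq_bigr => -[i j] _ /=.
by rewrite !mxvecE !mxE !big_ord1 !mxE starM !mulrA.
Qed.

Definition adjointable (E : lmodType A) (h : E -> E -> A) (C : E -> E) : Prop :=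
  exists Cstar : {linear E -> E}, forall x y, h (C x) y = h x (Cstar y).

(* For linear f, f is an isomorphism of E onto the submodule P(A^n). *)
Definition iso_onto_image (E : lmodType A) n (f : E -> 'rV[A]_n)
    (P : 'rV[A]_n -> 'rV[A]_n) : Prop :=
  injective f /\ range f = range P.

(* lin1_mx P is the matrix with P x = x *m lin1_mx P, see mul_rV_lin1. *)
Definition selfadjoint_idempotent n (P : {linear 'rV[A]_n -> 'rV[A]_n}) : Prop :=
  idempotent_fun P /\ dagger (lin1_mx P) = lin1_mx P.
End Hermitian.

(* Main.v *)
Require Import Defs.
From HB Require Import structures.
From mathcomp Require Import all_boot all_order all_algebra.
From mathcomp Require Import reals boolp classical_sets.

Set Implicit Arguments.
Unset Strict Implicit.
Unset Printing Implicit Defensive.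

Import GRing.Theory Num.Theory.
Local Open Scope ring_scope.

(** The embedding j of the module E into A^n identifies E with the image of a
    projection P satisfying P^dagger = P, and the Hermitian structure of E is
    that of A^n pulled back along j.  Since P is idempotent, corestricting it
    to its image gives a linear retraction g : A^n -> E of j with j \o g = P
    ([retraction_onto_image]).  An endomorphism C of E then extends to
    j \o C \o g on A^n, which is right multiplication by a matrix X, and
    right multiplication by X has adjoint right multiplication by X^dagger
    ([herm_mulmx]).  Compressing that adjoint back to E as
    g \o (- *m X^dagger) \o j gives an adjoint of C: the compression
    introduces a P in the right argument of the form, and, P being its own
    adjoint, it moves to the left one, where it fixes the image of j.

    This argument applies to any submodule cut out by a self-adjoint
    projection ([projective_adjointable]); the tensor product is the case
    where j embeds M (x) N into A^(ds), the form on A^d (x) A^s being by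
    definition the canonical one of A^(ds). *)

Section HermitianProjective.
Variables (R : realType) (A : starAlgType R).

Lemma star0 : star (0 : A) = 0.
Proof. by apply: (addIr (star (0 : A))); rewrite -starD !add0r. Qed.

Lemma star_sum (I : finType) (F : I -> A) :
  star (\sum_i F i) = \sum_i star (F i).
Proof. exact: (big_morph _ (@starD R A) star0). Qed.

(** The entries of X cross from one argument of the form to the other through
    the involution, whose reversal of products keeps the factors of each term
    in their order. *)
Lemma herm_mulmx m n (x : 'rV[A]_m) (X : 'M[A]_(m, n)) (y : 'rV[A]_n) :
  herm (x *m X) y = herm x (y *m dagger X).
Proof.
rewrite /herm.
under eq_bigr do rewrite mxE mulr_suml.
rewrite exchange_big; apply: eq_bigr => k _.
rewrite mxE star_sum mulr_sumr; apply: eq_bigr => i _.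
by rewrite !mxE starM starK mulrA.
Qed.

Lemma herm_selfadjoint n (P : {linear 'rV[A]_n -> 'rV[A]_n}) x y :
  selfadjoint_idempotent P -> herm (P x) y = herm x (P y).
Proof. by case=> _ P_sa; rewrite -!(mul_rV_lin1 P) herm_mulmx P_sa. Qed.

(** A module isomorphic to the image of a projection P is a direct summand:
    the projection itself, corestricted to its image, retracts the embedding.
    Injectivity of the embedding makes the chosen preimages depend linearly on
    the vector. *)
Lemma retraction_onto_image (E : lmodType A) n (j : {linear E -> 'rV[A]_n})
    (P : {linear 'rV[A]_n -> 'rV[A]_n}) :
  idempotent_fun P -> iso_onto_image j P ->
  exists2 g : {linear 'rV[A]_n -> E}, cancel j g & forall v, j (g v) = P v.
Proof.
move=> P_idem [j_inj j_P].
have preim v : exists x, j x = P v.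
  have : range j (P v) by rewrite j_P; exists v.
  by case=> x _ <-; exists x.
have [g jg] := boolp.choice preim.
have g_lin : linear g.
  by move=> a u v; apply: j_inj; rewrite linearP !jg linearP.
exists (HB.pack_for {linear 'rV[A]_n -> E} g
          (GRing.isLinear.Build A _ _ _ g g_lin)) => //= x.
apply: j_inj; rewrite jg.
have : range P (j x) by rewrite -j_P; exists x.
by case=> w _ <-; exact: P_idem.
Qed.

(** The form pulled back to a direct summand of A^n cut out by a self-adjoint
    projection behaves like the form of A^n itself: all endomorphisms have
    adjoints, obtained by extension to A^n and compression back. *)
Lemma projective_adjointable (E : lmodType A) n (j : {linear E -> 'rV[A]_n})
    (P : {linear 'rV[A]_n -> 'rV[A]_n}) (C : {linear E -> E}) :
  selfadjoint_idempotent P -> iso_onto_image j P ->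
  adjointable (fun x y => herm (j x) (j y)) C.
Proof.
move=> P_proj j_iso; have [P_idem _] := P_proj.
have [g gK jg] := retraction_onto_image P_idem j_iso.
pose X := lin1_mx (j \o C \o g).
exists (g \o (mulmxr (dagger X) \o j)) => x y /=.
rewrite jg -herm_selfadjoint // -jg gK -herm_mulmx.
by rewrite mul_rV_lin1 /= gK.
Qed.

End HermitianProjective.

Theorem proposition6p3 (R : realType) (A : starAlgType R) (d s : nat)
    (M : bimodType A) (N : lmodType A)
    (rho : {linear 'rV[A]_d -> 'rV[A]_d})
    (sigma : {linear 'rV[A]_s -> 'rV[A]_s})
    (rho_proj : selfadjoint_idempotent rho)
    (sigma_proj : selfadjoint_idempotent sigma)
    (iM : {linear M -> 'rV[A]_d}) (iM_iso : iso_onto_image iM rho)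
    (iN : {linear N -> 'rV[A]_s}) (iN_iso : iso_onto_image iN sigma)
    (P : {linear 'rV[A]_(d * s) -> 'rV[A]_(d * s)})
    (P_proj : selfadjoint_idempotent P)
    (iMN : {linear tensor M N -> tensor 'rV[A]_d 'rV[A]_s})
    (iMN_iso : iso_onto_image (@tensor_rV A d s \o iMN) P)
    (C : {linear tensor M N -> tensor M N}) :
  adjointable (fun x y : tensor M N => herm_tensor (iMN x) (iMN y)) C.
Proof.
exact: (@projective_adjointable R A _ _ (@tensor_rV A d s \o iMN) P C
          P_proj iMN_iso).
Qed.
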